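(* Let $G=(V,E,w)$ be any weighted undirected graph on $n$ vertices and let $k\ge 1$ be an integer. For every real $\epsilon>0$ there is a $(\beta,\epsilon)$-hopset $H$ for $G$ with $|H| = O\!\left(n^{1+\frac{1}{2^{k+1}-1}}\right)$ and $\beta = 2\left(\frac{(4+o(1))k}{\epsilon}\right)^k$.
   Context: For a weighted undirected graph $G=(V,E,w)$ (nonnegative edge lengths), $\dist_G(u,v)$ denotes the shortest-path distance, and $\dist_G^{(\beta)}(u,v)$ denotes the length of a shortest $u$--$v$ path in $G$ that uses at most $\beta$ edges (''hops''). A set $H\subseteq \binom{V}{2}$ of weighted edges is a $(\beta,\epsilon)$-hopset if for every $u,v\in V$, $\dist_G(u,v)\le \dist^{(\beta)}_{G\cup H}(u,v)\le (1+\epsilon)\dist_G(u,v)$, where $G\cup H$ is the graph obtained by adding the weighted edges of $H$ to $G$. The size of the hopset is $|H|$. *)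

(* Defs.v *)
From HB Require Import structures.
From mathcomp Require Import all_boot all_order all_algebra.
From mathcomp Require Import all_classical all_reals all_analysis.
Import Order.TTheory GRing.Theory Num.Theory.
Import numFieldNormedType.Exports.

Set Implicit Arguments.
Unset Strict Implicit.
Unset Printing Implicit Defensive.

Local Open Scope classical_set_scope.
Local Open Scope ring_scope.

(* Both the input graph and the hopset have this type: a hopset is itself a
   set of weighted 2-element subsets of V. The value of wt off edges is
   irrelevant. *)
Record wgraph (R : realType) (V : finType) := WGraph {
  edges : {set {set V}};
  wt : {set V} -> R;
  edges_card2 : forall e, e \in edges -> #|e| = 2%N;
  wt_ge0 : forall e, e \in edges -> 0 <= wt e
}.

Definition adj (R : realType) (V : finType) (G : wgraph R V) : rel V :=
  fun x y => [set x; y]%SET \in edges G.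

Definition union_wt (R : realType) (V : finType) (G H : wgraph R V)
    (e : {set V}) : R :=
  if e \in edges G then
    if e \in edges H then Num.min (wt G e) (wt H e) else wt G e
  else wt H e.

Lemma gunion_card2 (R : realType) (V : finType) (G H : wgraph R V) e :
  e \in (edges G :|: edges H)%SET -> #|e| = 2%N.
Proof. by rewrite inE => /orP[]; apply: edges_card2. Qed.

Lemma gunion_wt_ge0 (R : realType) (V : finType) (G H : wgraph R V) e :
  e \in (edges G :|: edges H)%SET -> 0 <= union_wt G H e.
Proof.
rewrite inE /union_wt; case: ifPn => [eG _|_ /= eH]; last exact: wt_ge0.
by case: ifPn => [eH|_]; rewrite ?le_min !wt_ge0.
Qed.

(* A pair that is an edge of both G and H would give two parallel edges; only
   the lighter one matters for distances, so it is the one kept. *)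
Definition gunion (R : realType) (V : finType) (G H : wgraph R V) :
    wgraph R V :=
  WGraph (@gunion_card2 R V G H) (@gunion_wt_ge0 R V G H).

(* The path starting at u and then visiting the vertices of p in order; it has
   [size p] edges. *)
Definition path_length (R : realType) (V : finType) (G : wgraph R V)
    (u : V) (p : seq V) : R :=
  \sum_(xy <- zip (u :: p) p) wt G [set xy.1; xy.2]%SET.

Definition uv_path (R : realType) (V : finType) (G : wgraph R V)
    (u v : V) (p : seq V) : Prop :=
  path (adj G) u p /\ last u p = v.

(* Paths may repeat vertices; as weights are nonnegative this does not change
   the distances, and the infimum is attained whenever a path exists. It is
   +oo when there is none. *)
Definition dist (R : realType) (V : finType) (G : wgraph R V) (u v : V) :
    \bar R :=
  ereal_inf [set (path_length G u p)%:E | p in [set p | uv_path G u v p]].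

(* The hop bound beta is a real number, not necessarily an integer. *)
Definition hop_dist (R : realType) (V : finType) (G : wgraph R V) (beta : R)
    (u v : V) : \bar R :=
  ereal_inf [set (path_length G u p)%:E |
    p in [set p | uv_path G u v p /\ (size p)%:R <= beta]].

Definition hopset (R : realType) (V : finType) (G : wgraph R V) (beta eps : R)
    (H : wgraph R V) : Prop :=
  forall u v : V,
    (dist G u v <= hop_dist (gunion G H) beta u v)%E /\
    (hop_dist (gunion G H) beta u v <= (1 + eps)%:E * dist G u v)%E.

(* Main.v *)
Require Import Defs.
From mathcomp Require Import all_boot all_order all_algebra.
From mathcomp Require Import all_classical all_reals all_analysis.
From mathcomp Require Import ring lra zify.
Import Order.TTheory GRing.Theory Num.Theory.
Import numFieldNormedType.Exports.
Local Open Scope classical_set_scope.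
Local Open Scope ring_scope.

(* The hopset is the Thorup-Zwick emulator of vertex sets V = A_0, ..., A_k and
   A_(k+1) = {}: each v in A_i is joined to a nearest vertex of A_(i+1) and to
   all the vertices of A_i that are strictly closer.

   Size. If A_(i+1) consists of s random vertices of A_i, then for fixed v
   the expected number of w in A_i closer to v than A_(i+1) is at most
   |A_i| / (s + 1): among s + 1 random vertices each is equally likely to be the
   strict minimum. Choosing |A_i| = n^(1 - (2^i - 1) / (2^(k+1) - 1)) / 2^i makes
   the number of edges at level i decrease geometrically, so the constant does
   not depend on k.

   Stretch. By induction on i, a G-path of length L can be replaced by a path
   with few hops and length at most (1 + 4 delta)^i L which either has the same
   ends or stops in A_(i+1). At the next level, cut the path into about
   1 / delta segments of length at most delta L separated by single edges. If
   some segments fail, go from the beginning of the first failing one to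
   z in A_(i+1) and from the end of the last failing one to z' in A_(i+1); then
   either {z, z'} is an edge of the hopset, or z is joined to a vertex of
   A_(i+2) at distance at most d(z, z'). *)

Set Implicit Arguments.
Unset Strict Implicit.
Unset Printing Implicit Defensive.

(** * Walks with hop and length bounds, and distances *)

Section Walks.
Variables (R : realType) (V : finType).
Implicit Types (G H : wgraph R V) (u v w : V) (a b l m : R).

(** Both [n] and [l] are upper bounds, so walks compose and weaken without exact lengths or an
    attained infimum. *)
Definition walk G (n : nat) u v l : Prop :=
  exists p, [/\ uv_path G u v p, (size p <= n)%N & path_length G u p <= l].

Lemma path_length_nil G u : path_length G u [::] = 0.
Proof. by rewrite /path_length big_nil. Qed.

Lemma path_length_cons G u v p :
  path_length G u (v :: p) = wt G [set u; v]%SET + path_length G v p.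
Proof. by rewrite /path_length /= big_cons. Qed.

Lemma path_length_cat G u p q :
  path_length G u (p ++ q) = path_length G u p + path_length G (last u p) q.
Proof.
elim: p u => [|v p IH] u /=; first by rewrite path_length_nil add0r.
by rewrite !path_length_cons IH addrA.
Qed.

Lemma path_length_ge0 G u p : path (adj G) u p -> 0 <= path_length G u p.
Proof.
elim: p u => [|v p IH] u /=; first by rewrite path_length_nil.
by case/andP=> uv vp; rewrite path_length_cons addr_ge0 ?IH // wt_ge0.
Qed.

Lemma walk_le G n n' u v l l' :
  (n <= n')%N -> l <= l' -> walk G n u v l -> walk G n' u v l'.
Proof.
move=> nn' ll' [p [up sp lp]]; exists p; split=> //; first exact: leq_trans nn'.
exact: le_trans ll'.
Qed.

Lemma walk_ge0 G n u v l : walk G n u v l -> 0 <= l.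
Proof. by case=> p [[up _] _]; apply: le_trans; apply: path_length_ge0. Qed.

Lemma walk_refl G u : walk G 0 u u 0.
Proof. by exists [::]; split; rewrite ?path_length_nil. Qed.

Lemma walk_edge G u v : adj G u v -> walk G 1 u v (wt G [set u; v]%SET).
Proof.
move=> uv; exists [:: v]; split; first by split; rewrite //= uv.
  by [].
by rewrite path_length_cons path_length_nil addr0.
Qed.

Lemma walk_trans G n n' u v w l l' :
  walk G n u v l -> walk G n' v w l' -> walk G (n + n') u w (l + l').
Proof.
case=> p [[up <-] sp lp] [q [[vq <-] sq lq]]; exists (p ++ q); split.
- by split; rewrite ?cat_path ?up ?last_cat.
- by rewrite size_cat leq_add.
- by rewrite path_length_cat lerD.
Qed.

Lemma adj_sym G u v : adj G u v = adj G v u.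
Proof. by rewrite /adj finset.setUC. Qed.

Lemma walk_sym G n u v l : walk G n u v l -> walk G n v u l.
Proof.
case=> p; elim: p u n l v => [|w p IH] u n l v [[/= up <-] sp].
  rewrite path_length_nil => l0.
  exact: walk_le (leq0n _) l0 (walk_refl _ _).
case/andP: up => uw wp; rewrite path_length_cons => lp.
have pw : walk G (size p) (last w p) w (path_length G w p) by apply: IH.
have wu : walk G 1 w u (wt G [set u; w]%SET).
  by rewrite finset.setUC; apply: walk_edge; rewrite adj_sym.
apply: (walk_le _ _ (walk_trans pw wu)); last by rewrite addrC.
by rewrite addn1.
Qed.

Lemma dist_le_walk G n u v l : walk G n u v l -> (dist G u v <= l%:E)%E.
Proof.
case=> p [up _ lp]; apply: ge_ereal_inf; exists (path_length G u p)%:E.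
  by exists p.
by rewrite lee_fin.
Qed.

Lemma dist_lt_walk G u v l :
  (dist G u v < l%:E)%E -> exists n, walk G n u v l.
Proof.
move/ereal_inf_ltP => [_ [p up <-]]; rewrite lte_fin => /ltW pl.
by exists (size p), p.
Qed.

Lemma dist_ge0 G u v : (0 <= dist G u v)%E.
Proof.
apply: le_ereal_inf_tmp => _ [p [up _] <-].
by rewrite lee_fin path_length_ge0.
Qed.

Lemma dist_sym_le G u v : (dist G u v <= dist G v u)%E.
Proof.
apply: le_ereal_inf_tmp => _ [p vp <-].
have /walk_sym/dist_le_walk // : walk G (size p) v u (path_length G v p).
by exists p.
Qed.

Lemma dist_sym G u v : dist G u v = dist G v u.
Proof. by apply/eqP; rewrite eq_le !dist_sym_le. Qed.

Lemma dist_trans G u v w a b :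
  (dist G u v <= a%:E -> dist G v w <= b%:E -> dist G u w <= (a + b)%:E)%E.
Proof.
move=> uv vw; apply/lee_addgt0Pr => e e0.
have e2 : 0 < e / 2 by rewrite divr_gt0.
have [|n nuv] := @dist_lt_walk G u v (a + e / 2).
  by apply: le_lt_trans uv _; rewrite lte_fin ltrDl.
have [|n' nvw] := @dist_lt_walk G v w (b + e / 2).
  by apply: le_lt_trans vw _; rewrite lte_fin ltrDl.
apply: le_trans (dist_le_walk (walk_trans nuv nvw)) _.
by rewrite -EFinD lee_fin; lra.
Qed.

Lemma dist_refl G u : (dist G u u <= 0%:E)%E.
Proof. exact: dist_le_walk (walk_refl _ _). Qed.

(** Such an [H] offers no shortcut below the distance in [G]; this gives the lower bound in
    [hopset]. *)
Definition dominates H G : Prop :=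
  forall u v, adj H u v -> (dist G u v <= (wt H [set u; v]%SET)%:E)%E.

Lemma adj_gunion G H u v : adj (gunion G H) u v = adj G u v || adj H u v.
Proof. by rewrite /adj /= inE. Qed.

Lemma dominates_gunion G H : dominates H G -> dominates (gunion G H) G.
Proof.
move=> HG u v; rewrite adj_gunion /= /union_wt.
have dG : adj G u v -> (dist G u v <= (wt G [set u; v]%SET)%:E)%E.
  by move=> uv; apply: dist_le_walk (walk_edge uv).
case: ifPn => [uvG _|/negPf nG]; last by rewrite {1}/adj nG; apply: HG.
case: ifPn => [uvH|_]; last exact: dG.
by rewrite EFin_min le_min dG // HG.
Qed.

Lemma dist_le_path G H u v p :
  dominates H G -> uv_path H u v p -> (dist G u v <= (path_length H u p)%:E)%E.
Proof.
move=> HG; elim: p u => [|w p IH] u [/= up vE].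
  by rewrite -vE path_length_nil; apply: dist_refl.
case/andP: up => uw wp; rewrite path_length_cons.
by apply: dist_trans (HG _ _ uw) (IH _ _).
Qed.

Lemma dominates_dist_le_walk G H n u v l :
  dominates H G -> walk H n u v l -> (dist G u v <= l%:E)%E.
Proof.
move=> HG [p [up _ pl]]; apply: le_trans (dist_le_path HG up) _.
by rewrite lee_fin.
Qed.

Lemma walk_gunion G H n u v l : walk G n u v l -> walk (gunion G H) n u v l.
Proof.
case=> p [[up uv] sp lp]; exists p; split=> //.
  split=> //; apply: sub_path up => x y xy.
  by rewrite adj_gunion xy.
apply: le_trans lp; elim: p u up {uv sp} => [|w p IH] u /=.
  by rewrite !path_length_nil.
case/andP=> uw wp; rewrite !path_length_cons lerD ?IH //= /union_wt.
rewrite -[_ \in edges G]/(adj G u w) uw.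
by case: ifP => // _; rewrite ge_min lexx.
Qed.

Lemma walk_gunion_edge G H u v :
  adj H u v -> walk (gunion G H) 1 u v (wt H [set u; v]%SET).
Proof.
move=> uv; have uv' : adj (gunion G H) u v by rewrite adj_gunion uv orbT.
apply: (walk_le _ _ (walk_edge uv')) => //=; rewrite /union_wt.
rewrite -[[set u; v]%SET \in edges H]/(adj H u v) uv.
by case: ifP => // _; rewrite ge_min lexx orbT.
Qed.

End Walks.

(** * Stretch and hop count along the levels *)

Section Stretch.
Variables (R : realType) (V : finType).
Implicit Types (G H : wgraph R V) (u v w : V) (l D : R) (S : {set V}).

(** Greedy cut at the first edge that takes the length past [D]. However heavy that edge is,
    dropping it with its prefix shortens the path by more than [D]. *)
Lemma path_segment G u v p D : 0 <= D -> uv_path G u v p ->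
  path_length G u p <= D \/
  exists x y q lx ly, [/\ uv_path G y v q /\ adj G x y,
    walk G (size p) u x lx /\ lx <= D,
    path_length G u p = lx + ly + path_length G y q,
    wt G [set x; y]%SET = ly & D < lx + ly].
Proof.
elim: p u D => [|w p IH] u D D0 [/= up vE]; first by left; rewrite path_length_nil.
case/andP: up => uw wp; rewrite path_length_cons.
have w0 : 0 <= wt G [set u; w]%SET by apply: wt_ge0.
case: (leP (wt G [set u; w]%SET) D) => wD; last first.
  right; exists u, w, p, 0, (wt G [set u; w]%SET); rewrite !add0r; split=> //.
  by split=> //; apply: (walk_le _ _ (walk_refl G u)).
have [||pD|[x [y [q [lx [ly [yq [ux xD] pE yE Dlt]]]]]]] :=
    IH w (D - wt G [set u; w]%SET) => //.
- by rewrite subr_ge0.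
- by left; lra.
right; exists x, y, q, (wt G [set u; w]%SET + lx), ly; split=> //; [|lra..].
split; last by lra.
exact: (walk_trans (walk_edge uw) ux).
Qed.

Definition reaches U n c S u v l : Prop :=
  walk U n u v (c * l) \/ exists2 a, a \in S & walk U n u a (c * l).

(* [x] starts the first failing segment and [y] ends the last one; [l1], [l2] and
   [l3] bound the lengths of the three parts of the path. The bound on [s] alone
   is needed when the part between two failing segments is discarded. *)
Definition near_pair G U S h c D e u v l : Prop :=
  exists x y z z' l1 l2 l3 s t,
    [/\ l1 + l2 + l3 <= l, z \in S, z' \in S, (s <= e + h)%N /\ (s + t <= e + h + h)%N &
    [/\ (dist G u x <= l1%:E)%E, (dist G x y <= l2%:E)%E
      & (dist G y v <= l3%:E)%E] /\
    [/\ walk U s u z (c * l1 + c * D), (dist G z x <= (c * D)%:E)%E,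
        walk U t z' v (c * l3 + c * D) & (dist G y z' <= (c * D)%:E)%E]].

(** Induction on [N]: every cut uses up more than [D], so [N.+1] segments suffice. Each cutting edge
    costs one extra hop. *)
Lemma scan_segments G U S h c D N u v p :
  dominates U G -> (forall x y l n, walk G n x y l -> walk U n x y l) ->
  1 <= c -> 0 <= D ->
  (forall x y l n, walk G n x y l -> reaches U h c S x y l) ->
  uv_path G u v p -> path_length G u p <= N.+1%:R * D ->
  walk U (N * h.+1 + h) u v (c * path_length G u p) \/
  near_pair G U S h c D (N * h.+1) u v (path_length G u p).
Proof.
move=> UG GU c1 D0 Hh.
(* The hypothesis is applied from both ends; success from either one gives the whole segment by
   symmetry, so a failure yields both [z] and [z']. *)
have seg e x y n l : walk G n x y l -> l <= D ->
    walk U (e + h) x y (c * l) \/ near_pair G U S h c D e x y l.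
  move=> xy lD; have l0 := walk_ge0 xy.
  have cl : c * l <= c * D by rewrite ler_wpM2l //; lra.
  case: (Hh _ _ _ _ xy) => [xyU|[z zS xz]].
    by left; apply: walk_le xyU; rewrite ?leq_addl.
  case: (Hh _ _ _ _ (walk_sym xy)) => [/walk_sym xyU|[z' zS' yz']].
    by left; apply: walk_le xyU; rewrite ?leq_addl.
  right; exists x, y, z, z', 0, l, 0, h, h; split=> //; [lra|clear; lia|].
  split; first by split; [exact: dist_refl|exact: dist_le_walk xy|exact: dist_refl].
  rewrite mulr0 add0r; split.
  - exact: walk_le xz.
  - by rewrite dist_sym; apply: dominates_dist_le_walk UG (walk_le (leqnn _) cl xz).
  - by apply: walk_sym; apply: walk_le yz'.
  - exact: dominates_dist_le_walk UG (walk_le (leqnn _) cl yz').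
elim: N u p => [|N IH] u p up lp.
  apply: seg; first by exists p.
  by rewrite -[D]mul1r.
have eS : (N.+1 * h.+1 = N * h.+1 + h + 1)%N by rewrite mulSn addnC -addnA addn1.
rewrite {}eS; set e := (N * h.+1)%N in IH *.
have wp : walk G (size p) u v (path_length G u p) by exists p.
have [pD|[x [y [q [lx [ly [[yq xy] [ux lxD] pE yE Dlt]]]]]]] := path_segment D0 up.
  exact: seg wp pD.
have lx0 := walk_ge0 ux.
have ly0 : 0 <= ly by rewrite -yE; apply: wt_ge0.
have q0 : 0 <= path_length G y q by case: yq => /path_length_ge0.
have lq : path_length G y q <= N.+1%:R * D.
  by move: lp; rewrite pE -[N.+2]addn1 natrD mulrDl mul1r; lra.
have xyG : walk G 1 x y ly by rewrite -yE; apply: walk_edge.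
have dxy := dist_le_walk xyG.
have duy := dist_trans (dist_le_walk ux) dxy.
have cly : ly <= c * ly by rewrite ler_peMl.
have wq : walk G (size q) y v (path_length G y q) by exists q.
case: (seg 0%N _ _ _ _ ux lxD) => [uxU|]; rewrite pE.
- have uyU := walk_trans uxU (GU _ _ _ _ xyG).
  case: (IH _ _ yq lq) => [yvU|].
    left; apply: walk_le (walk_trans uyU yvU); first by clear; lia.
    by rewrite !mulrDr; lra.
  case=> [x' [y' [z [z' [l1 [l2 [l3 [s [t [lE zS zS' [sh st]]]]]]]]]]].
  case=> [[d1 d2 d3] [yz zx zv yz']].
  right; exists x', y', z, z', (lx + ly + l1), l2, l3, (0 + h + 1 + s)%N, t.
  split=> //; [clear -lE; lra|clear -sh st; lia|split; split=> //].
    exact: dist_trans duy d1.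
  by apply: walk_le (walk_trans uyU yz) => //; rewrite !mulrDr; lra.
case=> [x1 [y1 [z1 [z1' [l1 [l2 [l3 [s [t [lE zS zS' [sh st]]]]]]]]]]].
case=> [[d1 d2 d3] [uz zx zv yz']].
case: (IH _ _ yq lq) => [yvU|].
  right; exists x1, y1, z1, z1', l1, l2, (l3 + ly + path_length G y q), s,
    (t + 1 + (e + h))%N.
  split=> //; [clear -lE; lra|clear -sh st; lia|split; split=> //].
    apply: dist_trans (dist_trans d3 dxy) _; exact: dist_le_walk wq.
  apply: walk_le (walk_trans (walk_trans zv (GU _ _ _ _ xyG)) yvU) => //.
  by rewrite !mulrDr; lra.
case=> [x2 [y2 [z2 [z2' [l1' [l2' [l3' [s' [t' [lE' zS2 zS2' [sh' st']]]]]]]]]]].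
case=> [[d1' d2' d3'] [uz' zx' zv' yz2']].
(* Two failures merge: the inner walks at [z1'] and [z2] are dropped and the lengths between join
   the middle part. As [s] is at most [h], the hops still fit. *)
right; exists x1, y2, z1, z2', l1, (l2 + (l3 + ly) + (l1' + l2')), l3', s, t'.
split=> //; [clear -lE lE'; lra|clear -sh st sh' st'; lia|split; split=> //].
by apply: dist_trans (dist_trans d2 (dist_trans d3 dxy)) (dist_trans d1' d2').
Qed.
Lemma level_stretch G U (A : nat -> {set V}) (k N : nat) (delta : R) :
  dominates U G -> (forall x y l n, walk G n x y l -> walk U n x y l) ->
  0 <= delta -> 1 <= N.+1%:R * delta -> A 0 = [set: V]%SET ->
  (forall i z z' m, (i <= k)%N -> z \in A i -> z' \in A i ->
     (dist G z z' <= m%:E)%E ->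
     walk U 1 z z' m \/ exists2 a, a \in A i.+1 & walk U 1 z a m) ->
  forall i, (i <= k)%N -> forall u v l n, walk G n u v l ->
    reaches U (2 * N.+2 ^ i).-1 ((1 + 4 * delta) ^+ i) (A i.+1) u v l.
Proof.
move=> UG GU d0 N1 A0 dich; elim=> [|i IH] ik u v l n uv.
  have inA0 x : x \in A 0%N by rewrite A0 inE.
  by rewrite /reaches mul1r; apply: dich (inA0 _) (inA0 _) (dist_le_walk uv).
have {}IH := IH (ltnW ik); set c := (1 + 4 * delta) ^+ i in IH.
have c1 : 1 <= c by apply: exprn_ege1; lra.
have cS : (1 + 4 * delta) ^+ i.+1 = c + 4 * delta * c by rewrite exprS mulrDl mul1r.
rewrite /reaches cS; set h := (2 * N.+2 ^ i).-1 in IH.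
have hS : h.+1 = (2 * N.+2 ^ i)%N by rewrite prednK // muln_gt0 expn_gt0.
(* The budget obeys h' + 1 = (N + 2)(h + 1): [N] segments each with a cutting edge, two more walks
   of [h] hops, and one hopset edge. *)
have hE : (2 * N.+2 ^ i.+1).-1 = (N * h.+1 + h + h + 1)%N.
  by rewrite expnS mulnCA -hS; clear; lia.
rewrite hE; clearbody h; set e := (N * h.+1)%N; clearbody c.
case: uv => p [up _ pl]; have pl0 : 0 <= path_length G u p.
  by case: up => /path_length_ge0.
have D0 : 0 <= delta * path_length G u p by apply: mulr_ge0.
have lN : path_length G u p <= N.+1%:R * (delta * path_length G u p).
  by rewrite mulrA ler_peMl.
have dc0 : 0 <= delta * c by apply: mulr_ge0 => //; lra.
have cl : (c + 4 * delta * c) * path_length G u p <= (c + 4 * delta * c) * l.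
  by apply: ler_wpM2l => //; rewrite -mulrA; lra.
case: (scan_segments UG GU c1 D0 IH up lN) => [uvU|].
  left; apply: walk_le uvU; first by clear; lia.
  apply: le_trans cl; rewrite mulrDl lerDl -!mulrA.
  by do 2 rewrite mulr_ge0 //; rewrite mulr_ge0 //; lra.
case=> [x [y [z [z' [l1 [l2 [l3 [s [t [lE zS zS' [_ st]]]]]]]]]]].
case=> [[d1 d2 d3] [uz zx zv yz]].
have l2c : l2 <= c * l2.
  by rewrite ler_peMl // -lee_fin; apply: le_trans d2; apply: dist_ge0.
have l3c : 0 <= c * l3.
  rewrite mulr_ge0 //; first by lra.
  by rewrite -lee_fin; apply: le_trans d3; apply: dist_ge0.
have clE : c * l1 + c * l2 + c * l3 <= c * path_length G u p.
  by rewrite -!mulrDr ler_wpM2l //; lra.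
have DE : c * (delta * path_length G u p) = delta * c * path_length G u p by ring.
(* With D the segment length, [z] and [z'] are at distance at most 2cD + [l2]. The walks to [z] and
   from [z'] add cD each, whence the factor [1 + 4 * delta]. *)
have zz' := dist_trans zx (dist_trans d2 yz); rewrite DE in uz zv zz'.
rewrite mulrDl -!mulrA (mulrA delta) in cl.
have Dp0 : 0 <= delta * c * path_length G u p by apply: mulr_ge0.
case: (dich _ _ _ _ ik zS zS' zz') => [zz|[a aS za]].
  left; apply: walk_le (walk_trans (walk_trans uz zz) zv); first by clear -st; lia.
  by rewrite mulrDl -!mulrA (mulrA delta); lra.
right; exists a => //; apply: walk_le (walk_trans uz za); first by clear -st; lia.
by rewrite mulrDl -!mulrA (mulrA delta); lra.
Qed.

Lemma hopset_of_levels G H (A : nat -> {set V}) (k N : nat) (delta beta eps : R) :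
  dominates H G -> 0 <= eps ->
  0 <= delta -> 1 <= N.+1%:R * delta -> A 0 = [set: V]%SET -> A k.+1 = finset.set0 ->
  (forall i z z' m, (i <= k)%N -> z \in A i -> z' \in A i ->
     (dist G z z' <= m%:E)%E -> walk (gunion G H) 1 z z' m \/
     exists2 a, a \in A i.+1 & walk (gunion G H) 1 z a m) ->
  (1 + 4 * delta) ^+ k <= 1 + eps -> (2 * N.+2 ^ k)%:R <= beta ->
  hopset G beta eps H.
Proof.
move=> HG eps0 d0 N1 A0 Ak dich c_eps hb u v.
have UG := dominates_gunion HG.
split.
  by apply: le_ereal_inf_tmp => _ [p [up _] <-]; apply: dist_le_path.
(* With the factor inside the infimum only single paths of [G] matter, so infinite distances need no
   separate case. *)
rewrite /dist -ereal_inf_pZl; last by lra.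
apply: le_ereal_inf_tmp => _ [_ [p up <-] <-].
have up' : walk G (size p) u v (path_length G u p) by exists p.
(* At level [k] the walk cannot stop early, because [A k.+1] is empty. *)
have [|[a]] := level_stretch UG (fun x y l n => @walk_gunion _ _ _ _ _ _ _ _) d0
    N1 A0 dich (leqnn k) up'; last by rewrite Ak inE.
case=> q [uq sq lq]; apply: ge_ereal_inf; exists (path_length (gunion G H) u q)%:E.
  exists q => //; split=> //; apply: le_trans hb.
  by rewrite ler_nat (leq_trans sq) // leq_pred.
rewrite -EFinM lee_fin; apply: le_trans lq _.
by apply: ler_wpM2r => //; case: up => /path_length_ge0.
Qed.

End Stretch.

(** * Pivot sets by averaging over random samples *)

Section Hitting.
Variables (V : finType) (disp : Order.disp_t) (X : orderType disp).
Variable (d : V -> V -> X).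

(* Drawing [s] elements of [A] and then one more is the same as drawing [s.+1]
   elements and singling out the [j]-th one. *)
Lemma sum_insert_ffun (s : nat) (A : {set V}) (j : 'I_s.+1)
    (F : V -> {ffun 'I_s -> V} -> nat) :
  (\sum_(f in ffun_on (mem A)) \sum_(w in A) F w f =
   \sum_(g in ffun_on (mem A)) F (g j) [ffun i => g (lift j i)])%N.
Proof.
rewrite pair_big_dep /=.
pose ins (fw : {ffun 'I_s -> V} * V) : {ffun 'I_s.+1 -> V} :=
  [ffun i => oapp fw.1 fw.2 (unlift j i)].
pose del (g : {ffun 'I_s.+1 -> V}) := ([ffun i => g (lift j i)], g j).
have insK : cancel ins del.
  case=> f w; rewrite /del /ins ffunE unlift_none /=; congr pair.
  by apply/ffunP => i; rewrite !ffunE liftK.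
have delK : cancel del ins.
  move=> g; apply/ffunP => i; rewrite ffunE /=.
  by case: unliftP => [i' ->|->] /=; rewrite ?ffunE.
rewrite (reindex del) /=; last by exists ins => x _; [apply: delK|apply: insK].
apply: eq_bigl => g; apply/andP/ffun_onP => [[/ffun_onP gA gj] i|gA].
  by case: (unliftP j i) => [i' ->|-> //]; have := gA i'; rewrite ffunE.
by split; [apply/ffun_onP => i; rewrite ffunE|]; apply: gA.
Qed.

(** Two strict minima would each be strictly closer to [v] than the other. *)
Lemma sum_strict_min_le1 (s : nat) (v : V) (g : {ffun 'I_s.+1 -> V}) :
  (\sum_(j < s.+1) [forall i, (d v (g j) < d v (g (lift j i)))%O] <= 1)%N.
Proof.
case: (boolP [exists j : 'I_s.+1, [forall i, (d v (g j) < d v (g (lift j i)))%O]]);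
    last first.
  rewrite negb_exists => /forallP H; rewrite big1 // => j _.
  by rewrite (negPf (H j)).
case/existsP=> j0 /forallP Hj0; rewrite (bigD1 j0) //= big1 ?addn0 ?leq_b1 // => j jj0.
case: forallP => // Hj.
have [i' jE _] := unlift_some jj0; have j0j : j0 != j by rewrite eq_sym.
have [i j0E _] := unlift_some j0j.
move: (Hj i') (Hj0 i); rewrite -jE -j0E => lt1 lt2.
by have := lt_trans lt1 lt2; rewrite ltxx.
Qed.

(** Averaging over all [s]-tuples of [A], repetitions allowed; [A'] is the image of a tuple that is
    at most average. *)
Lemma exists_hitting_set (s : nat) (A : {set V}) : exists A' : {set V},
  (#|A'| <= s)%N /\
  (s.+1 * \sum_(v in A) #|[set w in A | [forall a in A', (d v w < d v a)%O]]%SET|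
    <= #|A| ^ 2)%N.
Proof.
have [->|A0] := eqVneq A finset.set0.
  by exists finset.set0; rewrite cards0 big_set0 muln0.
pose S (f : {ffun 'I_s -> V}) :=
  (\sum_(v in A) \sum_(w in A) [forall i, (d v w < d v (f i))%O])%N.
suff [f Sf] : exists f, (s.+1 * S f <= #|A| ^ 2)%N.
  exists [set f i | i in 'I_s]%SET; split.
    by apply: leq_trans (leq_imset_card _ _) _; rewrite card_ord.
  apply: leq_trans _ Sf; rewrite leq_mul2l /=; apply: leq_sum => v vA.
  rewrite -sum1dep_card big_mkcondr; apply: leq_sum => w wA.
  case: ifP => // /forall_inP H; rewrite (_ : [forall i, _] = true) //.
  by apply/forallP => i; apply/H/imset_f.
(* The factor [s.+1] becomes a sum over positions [j]. Once [w] is inserted at [j], each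
   [s.+1]-tuple is counted at most once. *)
have total : (s.+1 * \sum_(f in ffun_on (mem A)) S f <= #|A| * #|A| ^ s.+1)%N.
  rewrite /S exchange_big /= big_distrr /= -sum_nat_const; apply: leq_sum => v vA.
  rewrite -[X in (X * _)%N](card_ord s.+1) -sum_nat_const.
  under eq_bigr => j _ do
    rewrite (sum_insert_ffun A j
      (fun w (f : {ffun 'I_s -> V}) => [forall i, (d v w < d v (f i))%O])).
  rewrite exchange_big /= -[X in (_ <= X)%N]muln1 -[X in (X ^ _)%N]/#|mem A|.
  rewrite -[X in (_ ^ X)%N](card_ord s.+1) -card_ffun_on -sum_nat_const.
  apply: leq_sum => g _; apply: leq_trans _ (sum_strict_min_le1 v g).
  apply: leq_sum => j _; rewrite (_ : [forall i, _] = [forall i, (d v (g j) < d v (g (lift j i)))%O]) //.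
  by apply: eq_forallb => i; rewrite ffunE.
(* Otherwise each of the |A|^s tuples contributes at least |A|^2 + 1, exceeding the total
   |A|^(s+2). *)
apply: contrapT => /forallNP noS.
have : (\sum_(f in ffun_on (mem A) : {pred {ffun 'I_s -> V}}) (#|A| ^ 2).+1 <= #|A| * #|A| ^ s.+1)%N.
  apply: leq_trans _ total; rewrite big_distrr /=; apply: leq_sum => f _.
  by rewrite ltnNge; apply/negP/noS.
rewrite sum_nat_const card_ffun_on card_ord -expnS mulnS -expnD addn2.
by rewrite -[X in (_ <= X)%N]add0n leq_add2r leqn0 expn_eq0 cards_eq0 (negPf A0).
Qed.

(** [B v] adds to the strictly closer vertices one nearest pivot, if any; this accounts for the term
    [s.+1 * #|A|]. *)
Lemma exists_pivots (s : nat) (A : {set V}) :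
  exists (A' : {set V}) (B : V -> {set V}),
  [/\ (#|A'| <= s)%N,
    (s.+1 * \sum_(v in A) #|B v| <= #|A| ^ 2 + s.+1 * #|A|)%N &
    forall v w, v \in A -> w \in A -> w \in B v \/
      exists a, [/\ a \in A', a \in B v & (d v a <= d v w)%O]].
Proof.
have [A' [A's A'A]] := exists_hitting_set s A.
pose P v := if [pick a in A'] is Some a0 then
  [set [arg min_(a < a0 in A') d v a]%O]%SET else finset.set0.
exists A', (fun v => [set w in A | [forall a in A', (d v w < d v a)%O]] :|: P v)%SET.
split=> //.
  apply: leq_trans (leq_add A'A (leqnn _)); rewrite -mulnDr leq_mul2l /=.
  rewrite -sum1_card -big_split /=; apply: leq_sum => v _.
  apply: leq_trans (leq_card_setU _ _) _; rewrite leq_add2l /P.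
  by case: pickP => [a _|_]; rewrite ?cards1 ?cards0.
move=> v w vA wA; case: (boolP [forall a in A', (d v w < d v a)%O]) => [wB|].
  by left; rewrite !inE wA wB.
rewrite negb_forall_in => /exists_inP [a aA']; rewrite -leNgt => avw.
right; rewrite /P; case: pickP => [a0 a0A'|/(_ a)]; last by rewrite aA'.
case: arg_minP => // b bA' bmin; exists b; split=> //.
  by rewrite !inE eqxx orbT.
by apply: le_trans avw; apply: bmin.
Qed.

End Hitting.

(** * Construction of the emulator *)

Section Construction.
Variables (R : realType) (V : finType) (G : wgraph R V).

Lemma exists_dist_graph (E : {set {set V}}) :
  (forall e, e \in E -> #|e| = 2%N) ->
  exists H : wgraph R V, edges H = E /\
    forall x y, adj H x y -> wt H [set x; y]%SET = fine (dist G x y).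
Proof.
move=> E2.
(* The weight comes from an arbitrary ordering of the two ends, harmless by symmetry of [dist]. *)
pose W (e : {set V}) : R := if [pick xy : V * V | e == [set xy.1; xy.2]%SET] is Some xy
  then fine (dist G xy.1 xy.2) else 0.
have W0 e : e \in E -> 0 <= W e.
  by move=> _; rewrite /W; case: pickP => // xy _; apply/fine_ge0/dist_ge0.
exists (WGraph E2 W0); split=> // x y _ /=; rewrite /W; case: pickP => [[a b] /= /eqP ab|/(_ (x, y))].
  have := finset.set21 x y; have := finset.set22 x y; have := finset.set21 a b.
  have := finset.set22 a b; rewrite -{1 2}ab {3 4}ab !inE.
  case/orP=> /eqP bE /orP[]/eqP aE /orP[]/eqP yE /orP[]/eqP xE; subst=> //; by rewrite dist_sym.
by rewrite /= eqxx.
Qed.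

Lemma exists_levels (k : nat) (s : nat -> nat) : s k.+1 = 0%N ->
  exists (A : nat -> {set V}) (b : nat -> nat) (H : wgraph R V),
  [/\ dominates H G, A 0 = [set: V]%SET, A k.+1 = finset.set0,
    (forall i z z' m, (i <= k)%N -> z \in A i -> z' \in A i ->
       (dist G z z' <= m%:E)%E -> walk (gunion G H) 1 z z' m \/
       exists2 a, a \in A i.+1 & walk (gunion G H) 1 z a m) &
    [/\ forall i, (#|A i.+1| <= s i.+1)%N,
      forall i, ((s i.+1).+1 * b i <= #|A i| ^ 2 + (s i.+1).+1 * #|A i|)%N &
      (#|edges H| <= \sum_(i < k.+1) b i)%N]].
Proof.
move=> sk.
have [F FP] := choice (fun As : {set V} * nat => exists_pivots (dist G) As.2 As.1).
have {FP} [B FP] := choice FP.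
pose A := fix L i := if i is j.+1 then F (L j, s i) else [set: V]%SET.
(* Loops are not edges, and an infinite distance would become weight 0 under [fine], which breaks
   domination. *)
pose C i v := [set w in B (A i, s i.+1) v | (w != v) && (dist G v w < +oo)%E]%SET.
pose E := (\bigcup_(i < k.+1) \bigcup_(v in A i) [set [set v; w] | w in C i v])%SET.
have E2 e : e \in E -> #|e| = 2%N.
  case/bigcupP=> i _ /bigcupP[v _ /imsetP[w]]; rewrite inE => /and3P[_ wv _] ->.
  by rewrite cards2 eq_sym wv.
have [H [HE Hwt]] := exists_dist_graph E2.
have HG : dominates H G.
  move=> x y xy; rewrite Hwt // fineK //.
  have : [set x; y]%SET \in E by rewrite -HE.
  case/bigcupP=> i _ /bigcupP[v _ /imsetP[w]]; rewrite inE => /and3P[_ _ vw] xyE.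
  have vwf : dist G v w \is a fin_num by rewrite ge0_fin_numE // dist_ge0.
  have := finset.set21 x y; have := finset.set22 x y; have := finset.set21 v w.
  have := finset.set22 v w; rewrite -{1 2}xyE {3 4}xyE !inE.
  by case/orP=> /eqP bE /orP[]/eqP aE /orP[]/eqP yE /orP[]/eqP xE; subst=> //;
    rewrite dist_sym.
have edge i z a m : (i <= k)%N -> z \in A i -> a \in B (A i, s i.+1) z ->
    (dist G z a <= m%:E)%E -> walk (gunion G H) 1 z a m.
  move=> ik zA aB zam; have [->|az] := eqVneq a z.
    apply: walk_le (walk_refl _ _) => //.
    by rewrite -lee_fin; apply: le_trans zam; apply: dist_ge0.
  have za_fin : (dist G z a < +oo)%E by apply: le_lt_trans zam _; apply: ltry.
  have za : adj H z a.
    rewrite /adj HE; apply/bigcupP; exists (Ordinal (n:=k.+1) (m:=i) ik) => //.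
    by apply/bigcupP; exists z => //; apply/imset_f; rewrite inE aB az.
  apply: walk_le (walk_gunion_edge _ za) => //.
  by rewrite Hwt // -lee_fin fineK // ge0_fin_numE // dist_ge0.
exists A, (fun i => \sum_(v in A i) #|B (A i, s i.+1) v|)%N, H; split=> //.
- by have [] := FP (A k, s k.+1); rewrite /= sk leqn0 cards_eq0 => /eqP.
- move=> i z z' m ik zA z'A zz'.
  have [_ _ /(_ z z' zA z'A) [z'B|[a [aA aB az']]]] := FP (A i, s i.+1).
    by left; apply: (edge i).
  by right; exists a => //; apply: (edge i) (le_trans az' zz').
split=> [i|i|]; [by have [] := FP (A i, s i.+1) | by have [] := FP (A i, s i.+1) |].
rewrite HE.
have card_cup (I : finType) (P : pred I) (S : I -> {set {set V}}) :
    (#|\bigcup_(i | P i) S i| <= \sum_(i | P i) #|S i|)%N.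
  elim/big_rec2: _ => [|i x T _ xT]; first by rewrite cards0.
  by apply: leq_trans (leq_card_setU _ _) _; rewrite leq_add2l.
apply: leq_trans (card_cup _ _ _) _; apply: leq_sum => i _.
apply: leq_trans (card_cup _ _ _) _; apply: leq_sum => v _.
apply: leq_trans (leq_imset_card _ _) _; apply: subset_leq_card.
by apply/fintype.subsetP => w; rewrite inE => /andP[].
Qed.

End Construction.

(** * Level sizes, edge count and choice of parameters *)

Section Numerics.
Variable R : realType.

Lemma geometric_half_sum (x : R) (m : nat) : 0 <= x ->
  \sum_(i < m) x / 2 ^+ i <= 2 * x.
Proof.
move=> x0; suff -> : \sum_(i < m) x / 2 ^+ i = 2 * x - 2 * (x / 2 ^+ m).
  by rewrite gerBl mulr_ge0 // divr_ge0 // exprn_ge0.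
elim: m => [|m IH]; first by rewrite big_ord0 expr0 divr1 subrr.
rewrite big_ord_recr /= IH exprS; field.
by rewrite expf_neq0 // pnatr_eq0.
Qed.

(* With q = n^(1/(2^(k+1)-1)), these sizes m_i satisfy m_0 = n and
   m_i^2 / m_(i+1) = 2 n q / 2^i, and m_(k+1) = 2^-(k+1) <= 1 because
   q^(2^(k+1)) = n q. *)
Definition level_target (n q : R) (i : nat) : R := n * q / (q ^+ (2 ^ i) * 2 ^+ i).

Lemma sum_levels_le (n q : R) (k : nat) (a s b : nat -> nat) :
  1 <= n -> 1 <= q -> q ^+ (2 ^ k.+1) = n * q ->
  (a 0)%:R <= n -> (forall i, a i.+1 <= s i.+1)%N ->
  (forall i, (1 <= i <= k)%N -> s i = Num.truncn (level_target n q i)) -> s k.+1 = 0%N ->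
  (forall i, (s i.+1).+1 * b i <= a i ^ 2 + (s i.+1).+1 * a i)%N ->
  (\sum_(i < k.+1) b i)%:R <= 6 * (n * q).
Proof.
move=> n1 q1 qk a0 as_ sM sk bE; set M := level_target n q in sM.
pose T i : R := n * q / 2 ^+ i.
have q0 : 0 < q by apply: lt_le_trans q1.
have n0 : 0 < n by apply: lt_le_trans n1.
have p20 i : 0 < 2 ^+ i :> R by rewrite exprn_gt0.
have qi0 i : 0 < q ^+ i by rewrite exprn_gt0.
have M0 i : 0 < M i by rewrite /M /level_target divr_gt0 ?mulr_gt0.
have T0 i : 0 < T i by rewrite /T divr_gt0 ?mulr_gt0.
have MT i : M i <= T i.
  by rewrite /M /level_target /T ler_pM2l ?mulr_gt0 // lef_pV2 ?posrE ?mulr_gt0 // ler_peMl ?exprn_ege1 // ltW.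
have M2 i : M i ^+ 2 = 2 * T i * M i.+1.
  rewrite /M /level_target /T (exprS _ i) expnSr exprM; field.
  by rewrite !lt0r_neq0.
(* Truncation loses less than one, which the successor restores; at the last level the size 0 is
   enough because the target is at most 1. *)
have Ms i : (i <= k)%N -> M i.+1 <= (s i.+1).+1%:R.
  rewrite leq_eqVlt => /orP[/eqP ->|ik]; last first.
    by rewrite sM ?ik //; apply/ltW/truncnS_gt.
  rewrite sk /M /level_target qk -[X in X / _]mulr1 -mulf_div divff ?lt0r_neq0 ?mulr_gt0 //.
  by rewrite mul1r mul1r invf_le1 // exprn_ege1 // ler1n.
have aM i : (i <= k)%N -> (a i)%:R <= M i.
  case: i => [_|i ik].
    by rewrite /M /level_target expn0 !expr1 expr0 mulr1 mulfK ?lt0r_neq0.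
  have := as_ i; rewrite sM ?ik // -(ler_nat R) => /le_trans; apply.
  by rewrite truncn_le ltW.
have bT i : (i <= k)%N -> (b i)%:R <= 3 * (n * q) / 2 ^+ i.
  move=> ik; have := bE i; rewrite -(ler_nat R) natrD natrX !natrM.
  set S := (s i.+1).+1%:R; have S0 : 0 < S by rewrite ltr0n.
  (* [2 * T i] pays for the strictly closer vertices and [T i] for the nearest pivots. *)
  have -> : 3 * (n * q) / 2 ^+ i = 2 * T i + T i by rewrite /T; field; rewrite lt0r_neq0.
  move=> bS; rewrite -(ler_pM2l S0); apply: le_trans bS _.
  rewrite mulrDr; apply: lerD; last first.
    by rewrite ler_pM2l //; apply: le_trans (MT i); apply: aM.
  apply: (@le_trans _ _ (M i ^+ 2)).
    by rewrite lerXn2r ?nnegrE ?ler0n ?(ltW (M0 i)) // aM.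
  by rewrite M2 mulrC ler_pM2r ?mulr_gt0 // Ms.
rewrite natr_sum; apply: (@le_trans _ _ (\sum_(i < k.+1) 3 * (n * q) / 2 ^+ i)).
  by apply: ler_sum => i _; apply: bT; rewrite -ltnS.
apply: le_trans (geometric_half_sum _ _) _; last by rewrite mulrA -natrM.
by rewrite !mulr_ge0 // ltW.
Qed.

(** A Bernoulli-type bound, by induction from (1 + y)(1 - (k+1)y) <= 1 - ky. *)
Lemma exprn_le_inv (y : R) (k : nat) : 0 <= y -> (1 + y) ^+ k * (1 - k%:R * y) <= 1.
Proof.
move=> y0; elim: k => [|k IH]; first by rewrite mul0r subr0 mulr1.
apply: le_trans IH; rewrite exprS mulrAC mulrC; apply: ler_wpM2l.
  by rewrite exprn_ge0 //; lra.
rewrite -[k.+1]addn1 natrD; have := ler0n R k; set K := k%:R => K0.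
have : 0 <= (K + 1) * (y * y) by rewrite !mulr_ge0 //; lra.
nra.
Qed.

Lemma exists_stretch_parameters (eps : R) (k : nat) : (1 <= k)%N -> 0 < eps ->
  exists (delta : R) (N : nat), [/\ 0 <= delta, 1 <= N.+1%:R * delta,
    (1 + 4 * delta) ^+ k <= 1 + eps &
    (2 * N.+2 ^ k)%:R <= 2 * ((4 + 6 * eps) * k%:R / eps) ^+ k].
Proof.
move=> k1 eps0; have k0 : 1 <= k%:R :> R by rewrite ler1n.
(* Chosen so that 1 - 4k delta is exactly 1/(1 + eps). *)
pose delta := eps / (4 * k%:R * (1 + eps)).
have d0 : 0 < delta by rewrite /delta divr_gt0 // mulr_gt0; lra.
have dE : delta^-1 = k%:R * (4 / eps + 4).
  by rewrite /delta; field; rewrite !lt0r_neq0 //; lra.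
pose N := Num.truncn delta^-1.
have [Nle Nlt] : N%:R <= delta^-1 /\ delta^-1 < N.+1%:R.
  by apply/andP; apply: truncn_itv; rewrite invr_ge0 ltW.
exists delta, N; split; first exact: ltW.
- by rewrite -ler_pdivrMr // div1r ltW.
- have d40 : 0 <= 4 * delta by lra.
  have := exprn_le_inv k d40.
  have -> : 1 - k%:R * (4 * delta) = (1 + eps)^-1.
    by rewrite /delta; field; rewrite !lt0r_neq0 //; lra.
  by rewrite ler_pdivrMr ?mul1r; last by lra.
rewrite natrM natrX ler_pM2l //; apply: lerXn2r; rewrite ?nnegrE ?ler0n //.
  by rewrite !(divr_ge0, mulr_ge0) //; lra.
(* The additive 2 in [N.+2] is enlarged to 2k, so that [k] factors out. *)
have -> : (4 + 6 * eps) * k%:R / eps = delta^-1 + 2 * k%:R.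
  by rewrite dE; field; rewrite lt0r_neq0.
by rewrite -[N.+2]addn2 natrD; lra.
Qed.

End Numerics.

(** * Assembly of the hopset theorem *)

Theorem theorem1 (R : realType) :
  exists (C : R) (eta : R -> R),
    (eta x @[x --> (0 : R)^'+] --> (0 : R)) /\
    forall (n k : nat) (V : finType) (G : wgraph R V) (eps : R),
      #|V| = n -> (1 <= k)%N -> 0 < eps ->
      exists H : wgraph R V,
        hopset G (2 * ((4 + eta eps) * k%:R / eps) ^+ k) eps H /\
        #|edges H|%:R <= C * n%:R `^ (1 + 1 / (2 ^+ k.+1 - 1)).
Proof.
(* The hop bound obtained is 2 (1/delta + 2)^k with 1/delta = k (4/eps + 4). *)
exists 6, (fun x => 6 * x); split.
  apply: cvg_at_right_filter; rewrite -[X in _ --> X](mulr0 6).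
  by apply: cvgM; [exact: cvg_cst|exact: cvg_id].
move=> n k V G eps Vn k1 eps0.
pose D := (2 ^ k.+1 - 1)%N.
have DS : D.+1 = (2 ^ k.+1)%N by rewrite /D subn1 prednK // expn_gt0.
have D0 : (0 < D)%N by rewrite -ltnS DS -[1%N]/(2 ^ 0)%N ltn_exp2l.
have DR : 2 ^+ k.+1 - 1 = D%:R :> R by rewrite -natrX -DS -natr1 addrK.
pose q : R := n%:R `^ (1 / D%:R).
pose s i := if (i <= k)%N then Num.truncn (level_target n%:R q i) else 0%N.
have sk : s k.+1 = 0%N by rewrite /s ltnn.
have [A [b [H [HG A0 Ak dich [As Ab Hb]]]]] := exists_levels G sk.
exists H; split.
  have [delta [N [d0 N1 c_eps hb]]] := exists_stretch_parameters k1 eps0.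
  exact: hopset_of_levels HG (ltW eps0) d0 N1 A0 Ak dich c_eps hb.
(* Without vertices there are no edges; the estimate [1 <= q] below relies on [n] being positive. *)
case: (posnP n) => [n0|n0].
  suff -> : edges H = finset.set0 by rewrite cards0 mulr_ge0 // powR_ge0.
  apply/eqP; rewrite -finset.subset0; apply/fintype.subsetP => e eH.
  have := max_card (mem e); rewrite Vn n0 leqn0 => e0.
  by have := edges_card2 eH; move: e0 => /eqP ->.
have n1 : 1 <= n%:R :> R by rewrite ler1n.
have q1 : 1 <= q by rewrite /q -[X in X <= _](powRr0 n%:R) ler_powR // divr_ge0.
have qD : q ^+ D = n%:R.
  by rewrite -powR_mulrn ?powR_ge0 // -powRrM divfK ?powRr1 ?pnatr_eq0 ?ler0n // -lt0n.
rewrite DR powRD ?powRr1 ?ler0n //; last by rewrite pnatr_eq0 -lt0n n0 implybT.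
apply: (@le_trans _ _ (\sum_(i < k.+1) b i)%N%:R); first by rewrite ler_nat.
apply: (sum_levels_le n1 q1 _ _ As _ sk Ab).
- by rewrite -DS exprS qD mulrC.
- by rewrite A0 cardsT Vn.
by move=> i /andP[_ ik]; rewrite /s ik.
Qed.
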